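(* Let $n>4$. There does not exist a quasi-isometric embedding of the warped cone $\mathcal{O}_{SO(n,\mathbb{Z}[1/5])}SO(n,\mathbb{R})$ into the warped cone $\mathcal{O}_{F_2}(\mathbb{S}^2)$ in the following sense: writing $\Gamma=SO(n,\mathbb{Z}[1/5])$, $X=SO(n,\mathbb{R})$, $\Lambda=F_2$, $Y=\mathbb{S}^2$, there do not exist constants $K\ge1$, $C\ge0$ and a family $\{\Phi_t:(X_t,d^X_t)\to(Y_t,d^Y_t)\}_{t\ge1}$ of Borel maps such that for all $t\ge 1$: 1. $\frac{d^X_t(x,x')}{K}-C\le d^Y_t\big(\Phi_t(x),\Phi_t(x')\big)\le K\,d^X_t(x,x')+C$ for all $x,x'\in X_t$; 2. $\Phi_t$ maps the $\Gamma$-orbits of $X_t$ to the $\Lambda$-orbits of $Y_t$; 3. $\mu^X\big(\Phi_t^{-1}(A)\big)\le K\mu^Y(A)$ for all Borel sets $A$ of $Y_t$.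
   Context: Finitely generated groups carry the word length $|\cdot|$ of a fixed finite symmetric generating set. For a group $\Gamma$ acting isometrically on a compact metric space $(X,d)$ and $t\ge1$, the $t$-th level of the warped cone $\mathcal{O}_\Gamma X$ is $(X_t,d^X_t)$, where $X_t=X$ as a set and $d^X_t$ is the largest metric with $d^X_t(x,y)\le t\,d(x,y)$ and $d^X_t(x,\gamma x)\le|\gamma|$ for all $x,y\in X$, $\gamma\in\Gamma$; explicitly $d^X_t(x,y)=\inf_{\gamma\in\Gamma}[t\,d(x,\gamma y)+|\gamma|]$. $SO(n,\mathbb{Z}[1/5])$ (matrices in $SO(n,\mathbb{R})$ with entries in $\mathbb{Z}[1/5]$) acts on $SO(n,\mathbb{R})$ by left translations; $SO(n,\mathbb{R})$ has a bi-invariant metric and $\mu^X$ is its Haar probability measure. $F_2$ is a non-abelian free group generated by two matrices $a,b\in SO(3,\overline{\mathbb{Q}})$ (real rotations with algebraic entries), acting by rotations on $\mathbb{S}^2$ with its round metric; $\mu^Y$ is the rotation-invariant probability measure on $\mathbb{S}^2$. ''Maps $\Gamma$-orbits to $\Lambda$-orbits'' means $\Phi_t(\Gamma x)\subseteq\Lambda\Phi_t(x)$ for all $x$. *)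

(* Defs.v *)
From HB Require Import structures.
From mathcomp Require Import all_boot all_order all_algebra.
From mathcomp Require Import all_classical all_reals all_analysis.

Set Implicit Arguments.
Unset Strict Implicit.
Unset Printing Implicit Defensive.

Import Order.TTheory GRing.Theory Num.Theory.
Import numFieldNormedType.Exports.

Local Open Scope classical_set_scope.
Local Open Scope ring_scope.

Definition words (G : groupType) (S : set G) (g : G) : set (seq G) :=
  [set w | (forall s, s \in w -> S s) /\ (\prod_(s <- w) s)%g = g].

Definition subgroup_gen (G : groupType) (S : set G) : set G :=
  [set g | words (S `|` [set s^-1%g | s in S]) g !=set0].

Definition fin_sym_generating (G : groupType) (H S : set G) : Prop :=
  [/\ finite_set S, forall s, S s -> S (s^-1)%g & subgroup_gen S = H].

(* Meaningful for symmetric [S] and [g] in [subgroup_gen S]: the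
   set is then a nonempty set of naturals, so the infimum is attained. *)
Definition word_length (R : realType) (G : groupType) (S : set G) (g : G) : R :=
  inf [set (size w)%:R | w in words S g].

(* Letters are pairs (which generator, is it inverted); a word is reduced when
   no letter is followed by its own inverse. *)
Definition letter (G : groupType) (a b : G) (l : bool * bool) : G :=
  let x := if l.1 then b else a in if l.2 then x^-1%g else x.

Definition reduced (w : seq (bool * bool)) : bool :=
  sorted (fun l l' => ~~ ((l.1 == l'.1) && (l.2 != l'.2))) w.

Definition freely_independent (G : groupType) (a b : G) : Prop :=
  forall w, w != [::] -> reduced w -> (\prod_(l <- w) letter a b l)%g <> 1%g.

Definition is_metric (R : realType) (X : Type) (d : X -> X -> R) : Prop :=
  [/\ forall x y, 0 <= d x y,
      forall x y, d x y = 0 <-> x = y,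
      forall x y, d x y = d y x
    & forall x y z, d x z <= d x y + d y z].

Definition metrizes (R : realType) (X : topologicalType) (d : X -> X -> R) :=
  is_metric d /\
  forall (x : X) (U : set X),
    nbhs x U <-> exists2 e : R, 0 < e & [set y | d x y < e] `<=` U.

Definition bi_invariant (R : realType) (G : groupType) (d : G -> G -> R) :=
  forall g x y, d (g * x)%g (g * y)%g = d x y /\ d (x * g)%g (y * g)%g = d x y.

Definition orbit_of (G X : Type) (act : G -> X -> X) (H : set G) (x : X) : set X :=
  [set act g x | g in H].

(* The metric of level [t] of the warped cone of [H] acting on [(X, d)], by the
   explicit formula for the largest metric that is at most [t * d] and moves
   points by at most the word length. *)
Definition warped_dist (R : realType) (G : groupType) (X : Type)
    (act : G -> X -> X) (H S : set G) (d : X -> X -> R) (t : R) (x y : X) : R :=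
  inf [set t * d x (act g y) + word_length R S g | g in H].

Notation borel T := (g_sigma_algebraType (@open T)).

(* For a group acting on [X] by homeomorphisms. *)
Definition invariant_measure (R : realType) (G : Type) (X : ptopologicalType)
    (act : G -> X -> X) (mu : set (borel X) -> \bar R) : Prop :=
  forall (g : G) (A : set (borel X)), measurable A ->
    mu (act g @^-1` A) = mu A.

Definition special_orthogonal (R : realType) n (A : 'M[R]_n) : bool :=
  (A^T *m A == 1%:M) && (\det A == 1).

Record SO (R : realType) (n : nat) :=
  MkSO { SOmx :> 'M[R]_n ; SOmxP : special_orthogonal SOmx }.

Section SOinstances.
Variables (R : realType) (n : nat).

HB.instance Definition _ := [isSub for @SOmx R n].
HB.instance Definition _ := [Choice of SO R n by <:].

Lemma SO1_subproof : special_orthogonal (1%:M : 'M[R]_n).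
Proof. by rewrite /special_orthogonal trmx1 mulmx1 det1 !eqxx. Qed.

Lemma SOM_subproof (A B : SO R n) : special_orthogonal (A *m B).
Proof.
case: A B => [A /andP[/eqP AA /eqP dA]] [B /andP[/eqP BB /eqP dB]] /=.
rewrite /special_orthogonal trmx_mul -mulmxA (mulmxA A^T) AA mul1mx BB eqxx /=.
by rewrite det_mulmx dA dB mulr1.
Qed.

Lemma SOV_subproof (A : SO R n) : special_orthogonal (A^T).
Proof.
case: A => [A /andP[/eqP AA /eqP dA]] /=.
by rewrite /special_orthogonal trmxK (mulmx1C AA) det_tr dA !eqxx.
Qed.

Definition SO1 : SO R n := MkSO SO1_subproof.
Definition SOM (A B : SO R n) : SO R n := MkSO (SOM_subproof A B).
Definition SOV (A : SO R n) : SO R n := MkSO (SOV_subproof A).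

Lemma SOMA : associative SOM.
Proof. by move=> A B C; apply: val_inj; rewrite /= mulmxA. Qed.

Lemma SO1M : left_id SO1 SOM.
Proof. by move=> A; apply: val_inj; rewrite /= mul1mx. Qed.

Lemma SOM1 : right_id SO1 SOM.
Proof. by move=> A; apply: val_inj; rewrite /= mulmx1. Qed.

Lemma SOVM : left_inverse SO1 SOV SOM.
Proof.
by move=> [A PA]; apply: val_inj => /=; case/andP: PA => /eqP.
Qed.

Lemma SOMV : right_inverse SO1 SOV SOM.
Proof.
by move=> [A PA]; apply: val_inj => /=; case/andP: PA => /eqP /mulmx1C.
Qed.

HB.instance Definition _ := isGroup.Build (SO R n) SOMA SO1M SOM1 SOVM SOMV.

HB.instance Definition _ := isPointed.Build (SO R n) SO1.
HB.instance Definition _ :=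
  Topological.copy (SO R n) (initial_topology (@SOmx R n)).

End SOinstances.

Definition Zinv5 (R : realType) : set R :=
  [set x | exists (m : int) (k : nat), x = m%:~R / 5%:R ^+ k].

Definition SO_Zinv5 (R : realType) (n : nat) : set (SO R n) :=
  [set A : SO R n | forall i j, Zinv5 (A i j)].

Definition algebraic_entries (R : realType) n (A : SO R n) : Prop :=
  forall i j, algebraicOver (ratr : rat -> R) (A i j).

Definition dotv (R : realType) n (u v : 'cV[R]_n) : R := \sum_i u i 0 * v i 0.

Record sphere2 (R : realType) :=
  MkSphere2 { spt :> 'cV[R]_3 ; sptP : dotv spt spt == 1 }.

Lemma dotv_SO (R : realType) n (A : SO R n) (u v : 'cV[R]_n) :
  dotv (A *m u) (A *m v) = dotv u v.
Proof.
have dotE (x y : 'cV[R]_n) : dotv x y = (x^T *m y) 0 0.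
  by rewrite mxE; apply: eq_bigr => i _; rewrite mxE.
case: A => [A /andP[/eqP AA _]] /=.
by rewrite !dotE trmx_mul -mulmxA (mulmxA A^T) AA mul1mx.
Qed.

Section SphereInstances.
Variable R : realType.

HB.instance Definition _ := [isSub for @spt R].
HB.instance Definition _ := [Choice of sphere2 R by <:].

Lemma sphere2_pole_subproof :
  dotv (delta_mx 0 0 : 'cV[R]_3) (delta_mx 0 0) == 1.
Proof.
rewrite /dotv big_ord_recl big1 ?addr0 => [|i _]; rewrite !mxE /= ?mulr1 //.
by rewrite mul0r.
Qed.

HB.instance Definition _ :=
  isPointed.Build (sphere2 R) (MkSphere2 sphere2_pole_subproof).
HB.instance Definition _ :=
  Topological.copy (sphere2 R) (initial_topology (@spt R)).

Lemma rotate_subproof (A : SO R 3) (v : sphere2 R) :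
  dotv (A *m v) (A *m v) == 1.
Proof. by rewrite dotv_SO; exact: sptP. Qed.

Definition rotate (A : SO R 3) (v : sphere2 R) : sphere2 R :=
  MkSphere2 (rotate_subproof A v).

Definition round_dist (u v : sphere2 R) : R := acos (dotv u v).

End SphereInstances.

(* Main.v *)
Require Import Defs.
From HB Require Import structures.
From mathcomp Require Import all_boot all_order all_algebra.
From mathcomp Require Import all_classical all_reals all_analysis.
From mathcomp Require Import lra.
Import Order.TTheory GRing.Theory Num.Theory.
Import numFieldNormedType.Exports.
Local Open Scope classical_set_scope.
Local Open Scope ring_scope.

(** Fix a scale and count points: the levels [X_t] are too big to be put into
the levels [Y_t], for dimension reasons alone.

Let [D := K (1 + C) + 1].  By the lower bound in the quasi-isometry
inequality, two points of [X_t] whose images are at warped distance at most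
[1] are at warped distance less than [D].  The two sides of this implication
are compared as [t] grows.

In the target, the identity of [Lambda] shows that the warped distance is at
most [t] times the round one, so cells of round diameter at most [1 / t] have
warped diameter at most [1].  Cutting the cube around the sphere into small
cubes produces such a partition with [O(t ^ 3)] cells ([sphere2_cells]).

In the source, [SO(n)] carries about [t ^ (n - 1)] points with pairwise
[dX]-distances at least [2 D / t].  They are obtained from an inverse
stereographic projection lifted from the sphere of dimension [n - 1] to [SO(n)]
([SO_stereographic_grid]), which separates them in the matrix norm, together
with the fact that every bi-invariant metric inducing the topology dominates a
multiple of that norm ([bi_invariant_dominates_norm]).  The latter is the
usual no-small-subgroups argument: an element close to [1] has a power of
controlled order that leaves a fixed neighbourhood of [1], and the distance to
[1] grows at most linearly along powers.

Two grid points in the same fibre of the composite with the partition are at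
warped distance less than [D], so the first is within [D / t] of a translate
of the second by one of the boundedly many elements of [Gamma] of length less
than [D] ([finite_word_ball]); each such translate is that close to at most one
grid point.  Hence all fibres have bounded size ([leq_card_fibres]) and
[t ^ (n - 1) = O(t ^ 3)], which is absurd for [n > 4] and [t] large. *)

Set Implicit Arguments.
Unset Strict Implicit.
Unset Printing Implicit Defensive.

(** * A pigeonhole principle *)

(** Inside a fibre, compare everything with one chosen point [w] of it: the
points [u] of the fibre receive distinct labels [i] with [Q u w i], so the
fibre has at most [M] points. *)
Lemma leq_card_fibres (T U : finType) (M : nat) (f : T -> U)
    (Q : T -> T -> 'I_M -> Prop) :
    (forall u v, f u = f v -> exists i, Q u v i) ->
    (forall u v w i, Q u w i -> Q v w i -> u = v) ->
  (#|T| <= #|U| * M)%N.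
Proof.
move=> fQ Qinj.
have rP u : [exists v, f v == f u] by apply/existsP; exists u.
(* A canonical representative of the fibre of [u]. *)
pose r u := xchoose (existsP (rP u)).
have rE u : f u = f (r u) by rewrite (eqP (xchooseP (existsP (rP u)))).
have rf u v : f u = f v -> r u = r v.
  by move=> fuv; apply: eq_xchoose => w; rewrite fuv.
pose h u := (f u, sval (cid (fQ u (r u) (rE u)))).
suff /leq_card : injective h by rewrite card_prod card_ord.
move=> u v [fuv huv]; have := svalP (cid (fQ v (r v) (rE v))).
rewrite -huv -(rf _ _ fuv); apply: Qinj.
exact: (svalP (cid (fQ u (r u) (rE u)))).
Qed.

(** * The round metric of the sphere *)

(** The right-hand side is [2 * sin (acos c)]; the mean value theorem for [sin]
on [0, acos c] concludes, as [cos >= c >= 1/2] there. *)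
Lemma acos_le_2sqrt (R : realType) (c : R) : 2^-1 <= c <= 1 ->
  acos c <= 2 * Num.sqrt (1 - c ^+ 2).
Proof.
move=> /andP[c2 c1].
have cI : -1 <= c <= 1 by apply/andP; split; lra.
have t0 := acos_ge0 cI.
have [x xI] := MVT_segment t0 (fun x _ => is_derive_sin x)
  (continuous_subspaceT (@continuous_sin R)).
rewrite sin0 !subr0 sin_acos // => ->.
have cx : c <= cos x.
  rewrite -[leLHS](@acosK R) ?in_itv //=.
  move: xI; rewrite in_itv /= => /andP[x0 xc].
  have xpi : x <= pi by rewrite (le_trans xc) ?acos_lepi.
  rewrite leNgt ltr_cos ?in_itv /= ?x0 ?xpi ?t0 ?acos_lepi //.
  by rewrite -leNgt.
rewrite mulrA ler_peMl //; lra.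
Qed.

Lemma dotv_bounds (R : realType) (u v : sphere2 R) : -1 <= dotv u v <= 1.
Proof.
have /eqP := sptP u; have /eqP := sptP v.
rewrite /dotv !big_ord_recl !big_ord0.
set i := lift _ _; set j := lift _ _ => hv hu.
have sq (x y : R) : 0 <= (x + y) ^+ 2 /\ 0 <= (x - y) ^+ 2.
  by split; exact: sqr_ge0.
have [p0 m0] := sq (spt u 0 0) (spt v 0 0).
have [p1 m1] := sq (spt u i 0) (spt v i 0).
have [p2 m2] := sq (spt u j 0) (spt v j 0).
by apply/andP; split; lra.
Qed.

Lemma round_dist_ge0 (R : realType) (u v : sphere2 R) : 0 <= round_dist u v.
Proof. exact/acos_ge0/dotv_bounds. Qed.

(** Entrywise [h]-close unit vectors satisfy [2 - 2 (u . v) = |u - v|^2 <= 3 h^2].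
The bound on [h] keeps the angle below [pi / 3], where it is comparable to its
sine. *)
Lemma round_dist_le (R : realType) (u v : sphere2 R) (h : R) : 0 <= h <= 2^-1 ->
  (forall i, `|spt u i 0 - spt v i 0| <= h) -> round_dist u v <= 4 * h.
Proof.
move=> /andP[h0 h2] uv.
have [hm h1] := andP (dotv_bounds u v).
have sq i : (spt u i 0 - spt v i 0) ^+ 2 <= h ^+ 2.
  by rewrite -real_normK ?num_real // lerXn2r ?nnegrE.
have dh : 2 - 2 * dotv u v <= 3 * h ^+ 2.
  have /eqP := sptP u; have /eqP := sptP v.
  move: (sq 0) (sq (lift 0 0)) (sq (lift 0 (lift 0 0))).
  rewrite /dotv !big_ord_recl !big_ord0; lra.
have hh : h ^+ 2 <= 4^-1 by nra.
rewrite /round_dist; apply: le_trans (acos_le_2sqrt _) _; first by apply/andP; split; lra.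
have -> : 4 * h = 2 * Num.sqrt ((2 * h) ^+ 2).
  by rewrite sqrtr_sqr ger0_norm; lra.
rewrite ler_pM2l // ler_sqrt ?sqr_ge0 //; nra.
Qed.

(** The cells are cut out by cubes of side [1 / m] in the ambient space.  This
gives [m ^ 3] cells instead of the optimal [m ^ 2], which the count for [SO(n)]
with [n > 4] can afford. *)
Lemma sphere2_cells (R : realType) (m : nat) : (2 <= m)%N ->
  exists cell : sphere2 R -> {ffun 'I_3 -> 'I_(2 * m).+1},
    forall u v, cell u = cell v -> round_dist u v <= 4 / m%:R.
Proof.
move=> m2; have m0 : 0 < m%:R :> R by rewrite ltr0n; case: m m2.
have rng (u : sphere2 R) i : -1 <= spt u i 0 <= 1.
  have /eqP := sptP u; rewrite /dotv (bigD1 i) //=.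
  set s := \sum_(_ | _) _; have : 0 <= s by apply: sumr_ge0 => j _; nra.
  by move=> s0 e; apply/andP; split; nra.
pose z (u : sphere2 R) i := m%:R * (spt u i 0 + 1).
have z0 u i : 0 <= z u i.
  by rewrite mulr_ge0 ?(ltW m0) //; case/andP: (rng u i); lra.
have zle u i : (Num.trunc (z u i) < (2 * m).+1)%N.
  rewrite truncn_lt_nat //; case/andP: (rng u i) => _ u1.
  rewrite -natr1 natrM /z; nra.
exists (fun u => [ffun i => Ordinal (zle u i)]) => u v /ffunP uv.
apply: round_dist_le => [|i].
  by rewrite invr_ge0 ltW //= lef_pV2 ?posrE // ler_nat.
have := uv i; rewrite !ffunE => -[tuv].
have /andP[a1 a2] := truncn_itv (z0 u i).
have /andP[b1 b2] := truncn_itv (z0 v i).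
rewrite -tuv in b1 b2; move: a1 a2 b1 b2; rewrite -natr1.
move: (_%:R : R) => k; rewrite /z => a1 a2 b1 b2.
rewrite -(ler_pM2l m0) divff ?gt_eqF // -[X in X * _]ger0_norm ?(ltW m0) // -normrM.
by rewrite ler_norml; apply/andP; split; lra.
Qed.

(** * The matrix norm and bi-invariant metrics *)

Section MxNorm.
Variable R : realType.

Lemma ler_mx_entry m n (A : 'M[R]_(m, n)) i j : `|A i j| <= `|A|.
Proof.
by rewrite [leRHS]/Num.norm /= mx_normrE; apply/bigmax_geP; right; exists (i, j).
Qed.

Lemma mx_norm_le m n (A : 'M[R]_(m, n)) (c : R) : 0 <= c ->
  (forall i j, `|A i j| <= c) -> `|A| <= c.
Proof.
move=> c0 Ac; rewrite [leLHS]/Num.norm /= mx_normrE.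
by apply: bigmax_le => // -[i j] _; exact: Ac.
Qed.

Lemma mx_norm_mul m n p (A : 'M[R]_(m, n)) (B : 'M[R]_(n, p)) :
  `|A *m B| <= n%:R * `|A| * `|B|.
Proof.
apply: mx_norm_le => [|i j]; first by rewrite !mulr_ge0.
rewrite mxE (le_trans (ler_norm_sum _ _ _)) //.
have -> : n%:R * `|A| * `|B| = \sum_(k < n) `|A| * `|B|.
  by rewrite sumr_const card_ord -mulrA mulr_natl.
by apply: ler_sum => k _; rewrite normrM ler_pM ?ler_mx_entry.
Qed.

(** Powers of [A] that stay near [1] force [A] to be very near [1]: writing
[A ^ m - 1 = (A - 1) (1 + A + ... + A ^ (m - 1))], the second factor is [m] up
to an error of norm at most [m / (2 n)], so that [m (A - 1)] is comparable to
[A ^ m - 1].  The dimension enters because the entrywise maximum norm is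
submultiplicative only up to that factor. *)
Lemma mx_powers_near1 n (A : 'M[R]_n.+1) (m : nat) :
    (forall k, (k <= m)%N -> `|A ^+ k - 1| <= (2 * n.+1%:R)^-1) ->
  m%:R * `|A - 1| <= n.+1%:R^-1.
Proof.
set e := (2 * _)^-1 => Ae; have n0 : 0 < n.+1%:R :> R by [].
have eE : e = 2^-1 * n.+1%:R^-1 by rewrite /e invfM.
have sE : (A - 1) *+ m =
    (A ^+ m - 1) - (A - 1) * \sum_(k < m) (A ^+ k - 1).
  rewrite subrX1 sumrB sumr_const card_ord mulrBr opprB addrCA subrr addr0.
  by rewrite mulr_natr.
have sumle : `|\sum_(k < m) (A ^+ k - 1)| <= m%:R * e.
  rewrite (le_trans (ler_norm_sum _ _ _)) // mulr_natl.
  rewrite -[m in leRHS]card_ord -sumr_const.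
  by apply: ler_sum => k _; apply/Ae/ltnW.
have : `|(A - 1) *+ m| <= e + n.+1%:R * `|A - 1| * (m%:R * e).
  rewrite sE (le_trans (ler_normB _ _)) // lerD ?Ae //.
  by rewrite (le_trans (mx_norm_mul _ _)) // ler_wpM2l // mulr_ge0.
rewrite normrMn -[X in X <= _]mulr_natl.
have -> : n.+1%:R * `|A - 1| * (m%:R * e) = 2^-1 * (m%:R * `|A - 1|).
  rewrite eE; transitivity (2^-1 * (m%:R * `|A - 1|) * (n.+1%:R / n.+1%:R)).
    by move: (n.+1%:R : R)^-1 (n.+1%:R : R) => x y; lra.
  by rewrite mulfV // mulr1.
rewrite eE; move: (n.+1%:R : R)^-1 => x; lra.
Qed.

Lemma SO_entry n (g : SO R n) i j : `|g i j| <= 1.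
Proof.
case: g => A /= /andP[/eqP AA _].
have := congr1 (fun M : 'M[R]_n => M j j) AA; rewrite /= !mxE eqxx mulr1n (bigD1 i) //=.
rewrite mxE; set s := \sum_(_ | _) _ => e.
have s0 : 0 <= s by apply: sumr_ge0 => k _; rewrite mxE -expr2 sqr_ge0.
rewrite -(@ler_pXn2r _ 2) ?nnegrE // real_normK ?num_real // expr1n expr2.
by rewrite -e lerDl.
Qed.

Lemma SO_expg n (g : SO R n.+1) k : SOmx (g ^+ k)%g = (SOmx g) ^+ k.
Proof. by elim: k => // k IH; rewrite expgS exprS -IH. Qed.

(** In other words [d x y < e / m] implies [|x - y| <= 1 / m].  By invariance one
may compare [1] with [g := x^-1 y]; the powers [g ^ k] with [k <= m] satisfy
[d 1 (g ^ k) <= k * d 1 g < e], hence stay in a fixed neighbourhood of [1], and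
[mx_powers_near1] applies.  No reverse inequality can be expected: the square
root of a bi-invariant metric is again one. *)
Lemma bi_invariant_dominates_norm n (d : SO R n.+1 -> SO R n.+1 -> R) :
    metrizes d -> bi_invariant d ->
  exists2 e : R, 0 < e &
    forall (m : nat) x y, m%:R * d x y < e -> m%:R * `|SOmx x - SOmx y| <= 1.
Proof.
move=> [[d0 d1 ds dt] dn] di.
pose U := [set g : SO R n.+1 | `|SOmx g - 1| <= (2 * n.+1%:R)^-1].
have nU : nbhs (1%g : SO R n.+1) U.
  have c : {for (1%g : SO R n.+1), continuous (@SOmx R n.+1)}.
    exact: initial_continuous.
  have n0 : 0 < (2 * n.+1%:R)^-1 :> R by rewrite invr_gt0 mulr_gt0.
  have : \forall g \near (1%g : SO R n.+1),
      ball (1 : 'M[R]_n.+1) (2 * n.+1%:R)^-1 (SOmx g).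
    exact: c _ (nbhsx_ballx _ _ n0).
  apply: filterS => g /= [_ gb].
  apply: mx_norm_le (ltW n0) _ => i j.
  by have /ltW := gb i j; rewrite distrC !mxE.
have [e e0 eU] := (dn _ _).1 nU; exists e => // m x y dxy.
pose g := (x^-1 * y)%g.
have dg : d 1%g g = d x y.
  by rewrite -(di x 1%g g).1 mulg1 /g mulVKg.
have dgk k : d 1%g (g ^+ k)%g <= k%:R * d 1%g g.
  elim: k => [|k IH]; first by rewrite expg0 (d1 _ _).2 // mul0r.
  rewrite expgS (le_trans (dt _ g _)) // -natr1 mulrDl mul1r addrC lerD2r.
  by rewrite -{1}[g]mulg1 (di _ _ _).1.
have mg : m%:R * `|SOmx g - 1| <= n.+1%:R^-1.
  apply: mx_powers_near1 => k km; rewrite -SO_expg; apply: eU => /=.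
  apply: le_lt_trans (dgk k) _; apply: le_lt_trans dxy.
  by rewrite dg ler_wpM2r ?ler_nat.
have yx : SOmx x - SOmx y = - (SOmx x *m (SOmx g - 1)).
  have -> : SOmx y = SOmx x *m SOmx g by rewrite -[RHS]/(SOmx (x * g)%g) mulVKg.
  by rewrite mulmxBr mulmx1 opprB.
rewrite yx normrN.
have x1 : `|SOmx x| <= 1 by apply: mx_norm_le => // i j; exact: SO_entry.
have n0 : 0 < n.+1%:R :> R by [].
apply: (@le_trans _ _ (n.+1%:R * (m%:R * `|SOmx g - 1|))).
  rewrite mulrCA ler_wpM2l // (le_trans (mx_norm_mul _ _)) //.
  by rewrite -mulrA ler_wpM2l // ler_piMl.
by rewrite -ler_pdivlMl ?mulr1.
Qed.
End MxNorm.

(** * A stereographic chart of the special orthogonal group *)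

(** The two sides are the Schur complements of the two diagonal blocks in
[block_mx 1 v w 1]. *)
Lemma det_1B_outer (R : comNzRingType) n (w : 'cV[R]_n) (v : 'rV[R]_n) :
  \det (1%:M - w *m v) = 1 - (v *m w) 0 0.
Proof.
have E : block_mx 1%:M 0 w 1%:M *m block_mx 1%:M v 0 (1%:M - w *m v) =
    block_mx (1%:M - v *m w) v 0 1%:M *m block_mx (1%:M : 'M[R]_1) 0 w 1%:M.
  rewrite !mulmx_block !mul1mx !mulmx1 !mul0mx !mulmx0 !addr0 !add0r.
  by rewrite subrK addrC subrK.
move/(congr1 determinant): E; rewrite !det_mulmx !det_lblock !det_ublock.
rewrite !det1 !mul1r !mulr1 => ->.
by rewrite det_mx11 !mxE eqxx.
Qed.

Definition reflection (R : fieldType) n (w : 'cV[R]_n) : 'M[R]_n :=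
  1%:M - (2 / (w^T *m w) 0 0) *: (w *m w^T).

Section Reflection.
Variables (R : fieldType) (n : nat) (w : 'cV[R]_n).
Hypothesis w0 : (w^T *m w) 0 0 != 0.

Lemma reflection_det : \det (reflection w) = -1.
Proof.
rewrite /reflection scalemxAr det_1B_outer -scalemxAl mxE divfK //.
by rewrite -[2]/(1 + 1) opprD addrA subrr sub0r.
Qed.

Lemma reflection_tr : (reflection w)^T = reflection w.
Proof. by rewrite linearB linearZ /= trmx1 trmx_mul trmxK. Qed.

Lemma reflectionK : reflection w *m reflection w = 1%:M.
Proof.
rewrite {2}/reflection mulmxBr mulmx1 -scalemxAr mulmxA.
have -> : reflection w *m w = - w.
  have E : w *m (w^T *m w) = (w^T *m w) 0 0 *: w.
    by rewrite {1}[w^T *m w]mx11_scalar mul_mx_scalar.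
  rewrite mulmxBl mul1mx -scalemxAl -mulmxA E.
  by rewrite scalerA divfK // scaler_nat mulr2n opprD addNKr.
by rewrite mulNmx scalerN opprK subrK.
Qed.

End Reflection.

Lemma reflection_pair_SO (R : realType) n (v w : 'cV[R]_n) :
    (v^T *m v) 0 0 != 0 -> (w^T *m w) 0 0 != 0 ->
  special_orthogonal (reflection v *m reflection w).
Proof.
move=> v0 w0; rewrite /special_orthogonal trmx_mul !reflection_tr -mulmxA.
rewrite (mulmxA (reflection v)) reflectionK // mul1mx reflectionK // eqxx /=.
by rewrite det_mulmx !reflection_det // mulrNN mulr1.
Qed.

(** With [w := (1, u)] and [e] the first basis vector, the product of the
reflections along [w] and [e] is a rotation sending [e] to [2 w / |w|^2 - e].
This first column is the point of the unit sphere whose stereographic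
projection from [- e] is [u], which is what the two equations say. *)
Lemma SO_stereographic (R : realType) (p : nat) (u : 'I_p -> R) :
  exists g : SO R p.+1,
    g 0 0 + 1 = 2 / (1 + \sum_i u i ^+ 2) /\
    forall i, g (lift 0 i) 0 = u i * (g 0 0 + 1).
Proof.
pose w : 'cV[R]_p.+1 := \col_k oapp u 1 (unlift 0 k).
pose e : 'cV[R]_p.+1 := delta_mx 0 0.
have ee : (e^T *m e) = 1%:M.
  by rewrite trmx_delta mul_delta_mx; apply/matrixP => i j; rewrite !ord1 !mxE.
have ww : (w^T *m w) 0 0 = 1 + \sum_i u i ^+ 2.
  rewrite mxE big_ord_recl !mxE unlift_none mulr1; congr (_ + _).
  by apply: eq_bigr => i _; rewrite !mxE liftK.
have w0 : (w^T *m w) 0 0 != 0.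
  by rewrite ww gt_eqF // ltr_pwDl // sumr_ge0 // => i _; exact: sqr_ge0.
have e0 : (e^T *m e) 0 0 != 0 by rewrite ee mxE eqxx oner_eq0.
exists (MkSO (reflection_pair_SO w0 e0)).
have E k : (reflection w *m reflection e) k 0 =
    2 / (1 + \sum_i u i ^+ 2) * w k 0 - (k == 0)%:R.
  have -> : (reflection w *m reflection e) k 0 =
      (reflection w *m (reflection e *m e)) k 0.
    by rewrite mulmxA -colE [RHS]mxE.
  have -> : reflection e *m e = - e.
    rewrite mulmxBl mul1mx -scalemxAl -mulmxA ee mulmx1 mxE eqxx divr1.
    by rewrite scaler_nat mulr2n opprD addNKr.
  rewrite mulmxN -colE -ww !mxE big_ord1 !mxE unlift_none /=; lra.
rewrite /= !E mxE unlift_none /= mulr1 subrK; split=> // i.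
by rewrite E mxE liftK /= subr0 mulrC.
Qed.

(** The coordinates [u i] of the chart are recovered from the first column of
[g] as quotients with denominator [g 0 0 + 1 >= 2 / (1 + p)] on the unit cube,
so they depend on the matrix in a Lipschitz way with constant [1 + p].  Points
of the grid of mesh [1 / N] thus have matrices at distance at least
[1 / ((1 + p) N)]; the factor 2 makes the inequality strict. *)
Lemma SO_stereographic_grid (R : realType) (p N : nat) :
  exists g : {ffun 'I_p -> 'I_N} -> SO R p.+1,
    forall u v, (2 * p.+1 * N)%:R * `|SOmx (g u) - SOmx (g v)| <= 1 -> u = v.
Proof.
pose c (u : {ffun 'I_p -> 'I_N}) i : R := (u i)%:R / N%:R.
have [g gP] := choice (fun u => SO_stereographic (c u)).
exists g => u v guv; apply/ffunP => i; apply/val_inj => /=.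
have N0 : 0 < N%:R :> R by rewrite ltr0n; case: (N) (u i) => [[]|].
have c01 (t : {ffun 'I_p -> 'I_N}) j : 0 <= c t j <= 1.
  by rewrite divr_ge0 //= ler_pdivrMr // mul1r ler_nat ltnW.
set h := `|_| in guv.
have hE j : `|g u j 0 - g v j 0| <= h.
  by apply: le_trans (ler_mx_entry _ j 0); rewrite !mxE.
have [gv gvi] := gP v; have [gu gui] := gP u.
have s1 : 2 / p.+1%:R <= g v 0 0 + 1.
  rewrite gv ler_pM2l // lef_pV2 ?posrE //.
    rewrite -natr1 addrC lerD2r -[p in leRHS]card_ord -sumr_const.
    by apply: ler_sum => j _; rewrite exprn_ile1 //; case/andP: (c01 v j).
  by rewrite ltr_pwDl // sumr_ge0 // => j _; exact: sqr_ge0.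
have P0 : 0 < p.+1%:R :> R by [].
have h0 : 0 <= h by exact: normr_ge0.
have cuv : `|c u i - c v i| <= p.+1%:R * h.
  have : `|(c u i - c v i) * (g v 0 0 + 1)| <= 2 * h.
    have -> : (c u i - c v i) * (g v 0 0 + 1) =
        (g u (lift 0 i) 0 - g v (lift 0 i) 0) - c u i * (g u 0 0 - g v 0 0).
      rewrite gui gvi; lra.
    rewrite (le_trans (ler_normB _ _)) // mulr2n mulrDl mul1r lerD //.
    rewrite normrM; case/andP: (c01 u i) => a0 a1.
    by rewrite -[leRHS]mul1r ler_pM // ger0_norm.
  rewrite normrM [X in _ * X]ger0_norm; last by rewrite (le_trans _ s1) ?divr_ge0.
  move=> le2; have := le_trans (ler_wpM2l (normr_ge0 _) s1) le2.
  rewrite mulrCA ler_pM2l // ler_pdivrMr // mulrC //.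
have : `|(u i)%:R - (v i)%:R| < 1 :> R.
  have -> : (u i)%:R - (v i)%:R = (c u i - c v i) * N%:R :> R.
    by rewrite mulrBl !divfK ?gt_eqF.
  rewrite normrM [X in _ * X]ger0_norm //.
  move: guv; rewrite !natrM => guv.
  have := ler_wpM2r (ltW N0) cuv.
  lra.
move=> /ltr_normlP[]; rewrite opprB !ltrBlDr !nat1r !ltr_nat !ltnS => a b.
by apply/eqP; rewrite eqn_leq b a.
Qed.

(** * Word lengths and warped metrics *)

Section WordLength.
Variables (R : realType) (G : groupType).
Implicit Types (S : set G) (g : G).

Lemma word_length_ge0 S g : 0 <= word_length R S g.
Proof.
rewrite /word_length; have [->|/set0P ne] := eqVneq [set ((size w)%:R : R) | w in words S g] set0.
  by rewrite inf0.
by apply: lb_le_inf => // _ [w _ <-].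
Qed.

Lemma word_length1 S : word_length R S 1%g = 0.
Proof.
apply/eqP; rewrite eq_le word_length_ge0 andbT.
apply: ge_inf; first by exists 0 => _ [w _ <-].
by exists [::] => //; split=> //; rewrite big_nil.
Qed.

Lemma subgroup_gen1 S : subgroup_gen S 1%g.
Proof. by exists [::]; split=> //; rewrite big_nil. Qed.

Lemma finite_short_words S k : finite_set S ->
  exists L : seq G, forall w,
    (forall s, s \in w -> S s) -> (size w <= k)%N -> (\prod_(s <- w) s)%g \in L.
Proof.
move=> /finite_seqP[l SE]; elim: k => [|k [L LP]].
  by exists [:: 1%g] => -[|//] _ _; rewrite big_nil mem_head.
exists (1%g :: [seq (s * g)%g | s <- l, g <- L]) => -[|s w] wS wk.
  by rewrite big_nil mem_head.
rewrite big_cons in_cons; apply/orP; right; apply/allpairsP.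
exists (s, \prod_(s <- w) s)%g; split=> //=.
  by have := wS s (mem_head _ _); rewrite SE.
by apply: LP => // x xw; apply: wS; rewrite in_cons xw orbT.
Qed.

Lemma finite_word_ball H S (r : R) : fin_sym_generating H S ->
  exists L : seq G, forall g, H g -> word_length R S g < r -> g \in L.
Proof.
move=> [finS symS <-].
have [L LP] := finite_short_words (Num.bound r) finS.
exists L => g [w0 [w0S w0g]] gr.
have /inf_lt : [set ((size w)%:R : R) | w in words S g] !=set0.
  exists (size w0)%:R, w0 => //; split=> // s /w0S [//|[x Sx <-]].
  exact: symS.
move=> /(_ r gr) [_ [w [wS <-] <-] wr]; apply: LP => //.
rewrite -(ler_nat R) ltW // (lt_trans wr) //.
exact: le_lt_trans (ler_norm _) (unstable.ltr_norm_bound r).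
Qed.

End WordLength.

Section Warped.
Variables (R : realType) (G : groupType) (X : Type) (act : G -> X -> X).
Variables (H S : set G) (d : X -> X -> R) (t : R).
Hypotheses (H1 : H 1%g) (d0 : forall x y, 0 <= d x y) (t0 : 0 <= t).

Lemma warped_dist_le x y : act 1%g y = y -> warped_dist act H S d t x y <= t * d x y.
Proof.
move=> y1; apply: ge_inf; last first.
  by exists 1%g => //; rewrite y1 word_length1 addr0.
by exists 0 => _ [g _ <-]; rewrite addr_ge0 ?mulr_ge0 ?word_length_ge0.
Qed.

Lemma warped_dist_lt x y r : warped_dist act H S d t x y < r ->
  exists g, [/\ H g, t * d x (act g y) < r & word_length R S g < r].
Proof.
move=> /inf_lt[|_ [g Hg <-] gr]; first by eexists; exists 1%g.
have := word_length_ge0 R S g; have := mulr_ge0 t0 (d0 x (act g y)).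
by exists g; split=> //; lra.
Qed.

End Warped.

(** * The packing obstruction *)

Lemma rotate1 (R : realType) (v : sphere2 R) : rotate 1%g v = v.
Proof. by apply/val_inj; rewrite /= mul1mx. Qed.

(** The counting argument at a single level, for a map that controls distances
only at scale [1].  The parameters are chosen in the order [B], [N], [t]: for every [N], the level [t] is such that the [N ^ p]
grid points are [2 D / t]-separated, and [t] is proportional to [N], so that
the target is covered by [(2 B N + 1) ^ 3] cells of warped diameter at most [1]
with [B] independent of [N].  As there are at most [size L] points in a fibre,
[N ^ p <= (2 B N + 1) ^ 3 * size L], which fails for the chosen [N]. *)
Lemma warped_level_obstruction (R : realType) (p : nat) (hp : (4 <= p)%N)
    (Gamma SGamma : set (SO R p.+1))
    (dX : SO R p.+1 -> SO R p.+1 -> R)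
    (Lambda SLambda : set (SO R 3)) (D : R) (D0 : 0 <= D) :
    fin_sym_generating Gamma SGamma -> metrizes dX -> bi_invariant dX ->
    Lambda 1%g ->
  exists2 t : R, 1 <= t &
    forall Phi : SO R p.+1 -> sphere2 R,
  ~ (forall x x',
      warped_dist (@rotate R) Lambda SLambda (@round_dist R) t
        (Phi x) (Phi x') <= 1 ->
      warped_dist (fun g y => (g * y)%g) Gamma SGamma dX t x x' < D).
Proof.
move=> hG hdX hinv L1.
have G1 : Gamma 1%g by case: hG => _ _ <-; exact: subgroup_gen1.
have dX0 x y : 0 <= dX x y by case: hdX => -[].
have dXs x y : dX x y = dX y x by case: hdX => -[].
have dXt x y z : dX x z <= dX x y + dX y z by case: hdX => -[].
have [e e0 eP] := bi_invariant_dominates_norm hdX hinv.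
have [L LP] := finite_word_ball D hG.
pose c : R := 4 + 16 * p.+1%:R * D / e.
have c0 : 4 <= c by rewrite lerDl divr_ge0 ?mulr_ge0 // ltW.
pose B := Num.bound c.
have Bc : c < B%:R by exact: archi_boundP (le_trans _ c0).
have B4 : (4 < B)%N by rewrite -(ltr_nat R) (le_lt_trans c0).
pose N := (27 * B ^ 3 * size L).+1.
pose m := (2 * p.+1 * N)%N.
pose t : R := 1 + 2 * D * m%:R / e.
have t1 : 1 <= t by rewrite lerDl divr_ge0 ?mulr_ge0 // ltW.
exists t => // Phi PhiP.
(* The sphere is cut at mesh [1 / (B N) <= 1 / (4 t)]. *)
have M2 : (2 <= B * N)%N.
  by rewrite mulnS (leq_trans _ (leq_addr _ _)) // (leq_trans _ B4).
have [cell cellP] := @sphere2_cells R _ M2.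
have [g gP] := SO_stereographic_grid R p N.
(* The label [i] names a short [gamma] bringing [g v] close to [g u]. *)
pose Q u v (i : 'I_(size L)) := t * dX (g u) (nth 1%g L i * g v)%g < D.
have /(_ Q) := @leq_card_fibres _ _ (size L) (fun u => cell (Phi (g u))).
have fQ u v : cell (Phi (g u)) = cell (Phi (g v)) -> exists i, Q u v i.
  move=> /cellP uv.
  have t0 : 0 <= t by rewrite (le_trans _ t1).
  have : warped_dist (@rotate R) Lambda SLambda (@round_dist R) t
      (Phi (g u)) (Phi (g v)) <= 1.
    apply: le_trans (warped_dist_le _ _ _ _ _ (rotate1 _)) _ => //.
      exact: round_dist_ge0.
    apply: le_trans (ler_wpM2l t0 uv) _.
    have BN0 : 0 < (B * N)%:R :> R by rewrite ltr0n (leq_trans _ M2).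
    rewrite mulrA ler_pdivrMr // mul1r natrM.
    have N1 : 1 <= N%:R :> R by rewrite ler1n.
    apply: (@le_trans _ _ (c * N%:R)); last by rewrite ler_wpM2r // ltW.
    rewrite /t /c /m !natrM.
    have -> : (4 + 16 * p.+1%:R * D / e) * N%:R =
        4 * N%:R + 16 * p.+1%:R * D / e * N%:R by rewrite mulrDl.
    rewrite mulrDl mul1r.
    have -> : 2 * D * (2 * p.+1%:R * N%:R) / e * 4 =
      16 * p.+1%:R * D / e * N%:R by lra.
    by rewrite lerD2r; lra.
  move=> /PhiP /(warped_dist_lt G1 dX0 t0)[h [Gh th hD]].
  have hL := LP h Gh hD; rewrite -index_mem in hL.
  by exists (Ordinal hL); rewrite /Q /= nth_index // -index_mem.
have Qinj u v w i : Q u w i -> Q v w i -> u = v.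
  rewrite /Q; move: (nth _ _ _ * _)%g => x uD vD.
  apply/gP/eP; rewrite -/m.
  have uv : t * dX (g u) (g v) < 2 * D.
    have := ler_wpM2l (le_trans ler01 t1) (dXt (g u) x (g v)).
    rewrite mulrDr (dXs x); lra.
  have := dX0 (g u) (g v); move: (dX _ _) uv => d uv d0.
  have te : t * e = e + 2 * D * m%:R by rewrite mulrDl mul1r divfK ?gt_eqF.
  have m0 : 0 <= m%:R :> R by [].
  rewrite ltNge; apply/negP => md.
  have : t * (m%:R * d) < t * e.
    rewrite te mulrCA; have := ler_wpM2l m0 (ltW uv); lra.
  rewrite ltr_pM2l ?(lt_le_trans _ t1) // ltNge md //.
(* Now [N ^ 4 <= N ^ p <= (3 B N) ^ 3 * size L = N ^ 3 * N.-1]. *)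
move=> /(_ fQ Qinj).
rewrite !card_ffun !card_ord => le1.
have le2 : (N ^ 4 <= N ^ p)%N by rewrite leq_pexp2l.
have le3 : ((2 * (B * N)).+1 ^ 3 <= (3 * (B * N)) ^ 3)%N.
  by rewrite leq_exp2r // -addn1 [(3 * _)%N]mulSn addnC leq_add2r (leq_trans _ M2).
have := leq_trans le2 (leq_trans le1 (leq_mul le3 (leqnn _))).
have -> : ((3 * (B * N)) ^ 3 * size L = N ^ 3 * (27 * B ^ 3 * size L))%N.
  by rewrite !expnMn [(B ^ 3 * N ^ 3)%N]mulnC mulnCA -!mulnA.
by rewrite expnSr leq_pmul2l ?expn_gt0 // ltnn.
Qed.

Unset Implicit Arguments.

Theorem corollary5p1 (R : realType) (n : nat) (hn : (4 < n)%N)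
    (SGamma : set (SO R n))
    (hSGamma : fin_sym_generating (@SO_Zinv5 R n) SGamma)
    (dX : SO R n -> SO R n -> R)
    (hdX : metrizes dX) (hdX_inv : bi_invariant dX)
    (muX : probability (borel (SO R n)) R)
    (hmuX : invariant_measure (fun g x : SO R n => (g * x)%g) muX)
    (a b : SO R 3)
    (ha : algebraic_entries a) (hb : algebraic_entries b)
    (hab : freely_independent a b)
    (SLambda : set (SO R 3))
    (hSLambda : fin_sym_generating (subgroup_gen [set a; b]) SLambda)
    (muY : probability (borel (sphere2 R)) R)
    (hmuY : invariant_measure (@rotate R) muY) :
  let Gamma := @SO_Zinv5 R n in
  let Lambda := subgroup_gen [set a; b] in
  let actX := fun g x : SO R n => (g * x)%g in
  let actY := @rotate R in
  let dXt := warped_dist actX Gamma SGamma dX in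
  let dYt := warped_dist actY Lambda SLambda (@round_dist R) in
  ~ exists (K C : R) (Phi : R -> SO R n -> sphere2 R),
      [/\ 1 <= K, 0 <= C &
        forall t : R, 1 <= t ->
          [/\ measurable_fun [set: borel (SO R n)]
                (Phi t : borel (SO R n) -> borel (sphere2 R)),
              forall x x' : SO R n,
                dXt t x x' / K - C <= dYt t (Phi t x) (Phi t x')
                  <= K * dXt t x x' + C,
              forall x : SO R n,
                Phi t @` orbit_of actX Gamma x `<=` orbit_of actY Lambda (Phi t x)
            & forall A : set (borel (sphere2 R)), measurable A ->
                (muX (Phi t @^-1` A) <= K%:E * muY A)%E ] ].
Proof.
case: n hn SGamma hSGamma dX hdX hdX_inv muX hmuX => // p hp SGamma hS dX hdX hinv muX _.
move=> Gamma Lambda actX actY dXt dYt [K [C [Phi [K1 C0 PhiP]]]].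
have D0 : 0 <= K * (1 + C) + 1.
  by rewrite addr_ge0 // mulr_ge0 ?addr_ge0 // (le_trans ler01).
have [t t1 tP] := warped_level_obstruction hp SLambda D0 hS hdX hinv
  (subgroup_gen1 [set a; b]).
apply: (tP (Phi t)) => x x' le1.
have [_ /(_ x x') /andP[lo _] _ _] := PhiP t t1.
have K0 : 0 < K by exact: lt_le_trans K1.
have : dXt t x x' / K <= 1 + C by rewrite -lerBlDr (le_trans lo).
rewrite ler_pdivrMr // mulrC => ?.
by rewrite ltr_pwDr.
Qed.
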